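(* Let $H\ge1$, $\varepsilon\in(0,0.1]$, $\delta\in(0,1]$. For any MHR distribution $F$ supported on $[1,H]$, Algorithm U executed with $\ell=1$, $r=H$, $\gamma=1/e$, error parameter $\varepsilon$ and failure parameter $\delta$ (and a sufficiently large absolute constant $C$) outputs a price $p^{\mathsf{Alg}}$ such that $$\Pr\big[\mathrm{Rev}(p^{\mathsf{Alg}})\ge(1-5\varepsilon)\,\mathrm{Rev}(p^{\mathsf{opt}})\big]\ge 1-\delta,$$ using a total of $\mathcal{O}\big(\tfrac{1}{\varepsilon^2}\log^4\tfrac{H}{\varepsilon}\log\tfrac1\delta\big)$ pricing queries.
   Context: Pricing query model: the buyer's value has unknown CDF $F(p)=\Pr[v<p]$; a query at price $p$ draws a fresh independent $v\sim F$ and reveals only $\mathbf 1\{v\ge p\}$. $q(p)=1-F(p)$, $\mathrm{Rev}(p)=p\,q(p)$, and $p^{\mathsf{opt}}\in\arg\max_p\mathrm{Rev}(p)$. $F$ (with density $f$) is MHR if the hazard rate $f(v)/(1-F(v))$ is nondecreasing on its support. Logarithms are natural. Algorithm U (input $\ell,r,\delta,\varepsilon,\gamma$; absolute constant $C$): Let $S_1=\{(1+\varepsilon)^k\ell: k\in\mathbb{N}_0,\ (1+\varepsilon)^k\ell\le r\}$, $S_{can}=\emptyset$, $i=1$, $\widetilde R=22\log^2(r/\ell)+44\log(r/\ell)\log(1/\varepsilon)+66\log(1/\varepsilon)$. While $|S_i|\ge 20$: let $\ell_i=\min S_i$, $r_i=\max S_i$, $a_i=\min\{p\in S_i: p>\ell_i+0.2(r_i-\ell_i)\}$,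 $b_i=\min\{p\in S_i:p>\ell_i+0.5(r_i-\ell_i)\}$. Post $b_i$ for $C\log(\widetilde R/\delta)\gamma^{-1}$ queries and let $\widehat q(b_i)$ be the empirical purchase fraction. If $\widehat q(b_i)<0.75\gamma$, set $S_{i+1}=S_i\cap[\ell_i,b_i]$, $i\leftarrow i+1$, continue. Otherwise add $a_i,b_i$ to $S_{can}$; for $p\in\{a_i,b_i\}$ post $p$ for $C\log(\widetilde R/\delta)\gamma^{-1}\varepsilon^{-2}$ queries and set $\widehat{\mathrm{Rev}}(p)=p\cdot$(empirical purchase fraction). If $(1+\varepsilon)\widehat{\mathrm{Rev}}(a_i)<(1-\varepsilon)\widehat{\mathrm{Rev}}(b_i)$ set $S_{i+1}=S_i\cap[a_i,r_i]$, else $S_{i+1}=S_i\cap[\ell_i,b_i]$; $i\leftarrow i+1$. After the loop, add every $p$ of the final set to $S_{can}$, estimate $\widehat{\mathrm{Rev}}(p)$ for each $p\in S_{can}$ with $C\log(\widetilde R/\delta)\gamma^{-1}\varepsilon^{-2}$ fresh queries, and output $p^{\mathsf{Alg}}=\arg\max_{p\in S_{can}}\widehat{\mathrm{Rev}}(p)$.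
   Formalization: The query bound is proved with the factor 1 + log(1/δ) in place of log(1/δ): the literal bound is zero at δ = 1, although the algorithm still makes queries; for δ bounded away from 1 the two bounds agree up to a constant. *)

(* Defs.v *)
From HB Require Import structures.
From mathcomp Require Import all_boot all_order all_algebra.
From mathcomp Require Import all_classical all_reals all_analysis.

Set Implicit Arguments.
Unset Strict Implicit.
Unset Printing Implicit Defensive.

Import Order.TTheory GRing.Theory Num.Theory.
Import numFieldNormedType.Exports.
Local Open Scope classical_set_scope.
Local Open Scope ring_scope.

Definition is_density (R : realType) (f : R -> R) : Prop :=
  measurable_fun setT f /\ (forall x, 0 <= f x) /\
  (\int[lebesgue_measure]_x (f x)%:E = 1)%E.

Definition supported_on (R : realType) (f : R -> R) (lo hi : R) : Prop :=
  forall x, (x < lo \/ hi < x) -> f x = 0.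

Definition cdf (R : realType) (f : R -> R) (p : R) : R :=
  fine (\int[lebesgue_measure]_(x in `]-oo, p[%classic) (f x)%:E).

Definition survival (R : realType) (f : R -> R) (p : R) : R := 1 - cdf f p.

Definition Rev (R : realType) (f : R -> R) (p : R) : R := p * survival f p.

(* MHR: the hazard rate f(v)/(1-F(v)) is nondecreasing (where it is
   defined, i.e. on {v : 1 - F(v) > 0}, which contains the support up to
   its right end point). *)
Definition MHR (R : realType) (f : R -> R) : Prop :=
  forall x y, x <= y -> 0 < survival f y ->
    f x / survival f x <= f y / survival f y.

(* Adaptive pricing-query algorithms as query trees.                   *)
(* A node [Query p k] posts price p; a fresh v ~ F is drawn and the    *)
(* algorithm continues with [k (v >= p)].  A leaf [Ret p] outputs p.   *)

Inductive qtree (R : Type) : Type :=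
| Ret of R
| Query of R & (bool -> qtree R).
Arguments Ret {R}.
Arguments Query {R}.

Fixpoint prob (R : realType) (q : R -> R) (P : pred R) (t : qtree R) : R :=
  match t with
  | Ret p => (P p)%:R
  | Query p k => q p * prob q P (k true) + (1 - q p) * prob q P (k false)
  end.

Fixpoint nqueries (R : Type) (t : qtree R) : nat :=
  match t with
  | Ret _ => 0%N
  | Query _ k => (maxn (nqueries (k true)) (nqueries (k false))).+1
  end.

Fixpoint post (R : Type) (p : R) (m : nat) (k : nat -> qtree R) : qtree R :=
  match m with
  | 0%N => k 0%N
  | m'.+1 => Query p (fun b => post p m' (fun c => k (nat_of_bool b + c)%N))
  end.

Definition frac (R : realType) (c m : nat) : R := c%:R / m%:R.

Definition Rtilde (R : realType) (l r eps : R) : R :=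
  22 * ln (r / l) ^+ 2 + 44 * ln (r / l) * ln (eps^-1) + 66 * ln (eps^-1).

Definition m1 (R : realType) (l r delta eps gamma C : R) : nat :=
  `| Num.ceil (C * ln (Rtilde l r eps / delta) / gamma) |%N.

Definition m2 (R : realType) (l r delta eps gamma C : R) : nat :=
  `| Num.ceil (C * ln (Rtilde l r eps / delta) / gamma / eps ^+ 2) |%N.

(* S_1 = {(1+eps)^k l : k in N, (1+eps)^k l <= r}, listed increasingly.
   Every such k satisfies k < truncn (r/(l eps)) + 1 (as (1+eps)^k >= 1+k eps),
   so filtering this finite range gives exactly S_1. *)
Definition S1 (R : realType) (l r eps : R) : seq R :=
  [seq p <- [seq (1 + eps) ^+ k * l | k <- iota 0 (Num.truncn (r / (l * eps))).+1]
   | p <= r].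

Fixpoint estimate (R : realType) (m : nat) (ps : seq R)
    (k : seq (R * R) -> qtree R) : qtree R :=
  match ps with
  | [::] => k [::]
  | p :: ps' => post p m (fun c => estimate m ps' (fun l => k ((p, p * frac R c m) :: l)))
  end.

Fixpoint best (R : realType) (d : R * R) (l : seq (R * R)) : R * R :=
  match l with
  | [::] => d
  | x :: l' => best (if d.2 < x.2 then x else d) l'
  end.

Definition argmax_est (R : realType) (l : seq (R * R)) : R :=
  (best (head (0, 0) l) (behead l)).1.

Definition final (R : realType) (M2 : nat) (S Scan : seq R) : qtree R :=
  estimate M2 (undup (Scan ++ S)) (fun l => Ret (argmax_est l)).

(* The while loop; S is the current set S_i (increasing list), Scan the
   candidate list.  [fuel] only guarantees structural termination; it is
   never exhausted since each iteration strictly shrinks S. *)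
Fixpoint loopU (R : realType) (eps gamma : R) (M1 M2 : nat) (fuel : nat)
    (S Scan : seq R) : qtree R :=
  match fuel with
  | 0%N => final M2 S Scan
  | fuel'.+1 =>
    if (size S < 20)%N then final M2 S Scan else
    let li := head 0 S in
    let ri := last 0 S in
    let ai := head ri [seq p <- S | li + 5^-1 * (ri - li) < p] in
    let bi := head ri [seq p <- S | li + 2^-1 * (ri - li) < p] in
    post bi M1 (fun c =>
      if frac R c M1 < (3 / 4) * gamma then
        loopU eps gamma M1 M2 fuel' [seq p <- S | li <= p <= bi] Scan
      else
        let Scan' := Scan ++ [:: ai; bi] in
        post ai M2 (fun ca => post bi M2 (fun cb =>
          let Ra := ai * frac R ca M2 in
          let Rb := bi * frac R cb M2 in
          if (1 + eps) * Ra < (1 - eps) * Rb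
          then loopU eps gamma M1 M2 fuel' [seq p <- S | ai <= p <= ri] Scan'
          else loopU eps gamma M1 M2 fuel' [seq p <- S | li <= p <= bi] Scan')))
  end.

Definition algU (R : realType) (l r delta eps gamma C : R) : qtree R :=
  let S := S1 l r eps in
  loopU eps gamma (m1 l r delta eps gamma C) (m2 l r delta eps gamma C)
        (size S).+1 S [::].

(* Main.v *)
(** Let q be the survival function and h = f / q the hazard rate.  Monotonicity of h
    gives, for x <= y,
      h(x) q(y) (y - x) <= q(x) - q(y) <= h(y) q(x) (y - x),
    and this inequality alone yields all that is needed about revenue curves: with p
    the optimal price, x h(x) <= 1 for x < p, hence (subdividing [0, x]) q(p) >= 0.31;
    revenue is nonincreasing after p; and Rev(p) - Rev(b) is at most the slope of Rev
    on [a, b] times p - b for a < b < p.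

    Along the loop either the current grid brackets p, or a candidate b with
    Rev(b) >= (1 - 4.9 eps) Rev(p) dominating the grid has been recorded.  Discarding
    the prices above b when q(b) looks small is safe since q(p) is bounded below;
    discarding those below a is safe by monotonicity after p; discarding those above
    b while p > b makes b near-optimal, by concavity before p.  The grid width
    shrinks by 4/5 in each round, so there are O(log(H / eps)) rounds, and a union
    bound over Chernoff bounds for the posted prices concludes. *)

Require Import Defs.
From HB Require Import structures.
From mathcomp Require Import all_boot all_order all_algebra.
From mathcomp Require Import all_classical all_reals all_analysis.
From mathcomp Require Import measurable_realfun ring lra zify.
Set Implicit Arguments.
Unset Strict Implicit.
Unset Printing Implicit Defensive.
Import Order.TTheory GRing.Theory Num.Theory.
Local Open Scope ring_scope.

(** * The survival function *)

Section SurvivalFunction.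
Context (R : realType) (f : R -> R) (f_density : is_density f).
Local Notation mu := (@lebesgue_measure R).
Local Notation q := (survival f).

Lemma density_integrable : mu.-integrable setT (EFin \o f).
Proof.
case: f_density => mf [f0 f1].
apply/integrableP; split; first exact/measurable_EFinP.
under eq_integral do rewrite /= ger0_norm//.
by rewrite f1 ltry.
Qed.

Lemma density_integrableS (A : set R) : measurable A ->
  mu.-integrable A (EFin \o f).
Proof. by move=> mA; apply: integrableS density_integrable. Qed.

Lemma survivalB (x y : R) : x <= y ->
  q x - q y = \int[mu]_(t in `[x, y[%classic) f t.
Proof.
move=> xy.
have <- : Defs.cdf f y - Defs.cdf f x = q x - q y by rewrite /survival; ring.
rewrite /Defs.cdf; have -> : `]-oo, y[%classic = (`]-oo, x[ `|` `[x, y[)%classic.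
  by rewrite (@itv_bndbnd_setU _ _ _ (BLeft x)).
rewrite -!/(Rintegral _ _ _) Rintegral_setU//; first by rewrite addrAC subrr add0r.
  by apply: density_integrableS; exact: measurableU.
by apply/disj_setPS => t [/=]; rewrite !in_itv/= => tx /andP[]; rewrite leNgt tx.
Qed.

Lemma survival_nonincreasing (x y : R) : x <= y -> q y <= q x.
Proof.
move=> xy; rewrite -subr_ge0 survivalB//.
by apply: Rintegral_ge0 => t _; case: f_density => _ [].
Qed.

Lemma survival_ge0 (x : R) : 0 <= q x.
Proof.
case: f_density => mf [f0 f1]; rewrite subr_ge0 -[leRHS]/(fine 1%E) -f1.
apply: fine_le.
- apply: (integrable_fin_num (mu := mu)) => //=.
  by apply: density_integrableS.
- by rewrite f1.
- apply: ge0_subset_integral => //; first exact/measurable_EFinP.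
  by move=> t _; rewrite lee_fin.
Qed.

Lemma survival_le1 (x : R) : q x <= 1.
Proof.
rewrite lerBlDr lerDl; apply: Rintegral_ge0 => t _.
by case: f_density => _ [].
Qed.

Lemma survivalB_bounds (lo hi x y : R) : x <= y ->
  (forall t, x <= t < y -> lo <= f t <= hi) ->
  lo * (y - x) <= q x - q y <= hi * (y - x).
Proof.
move=> xy fb.
have intc (c : R) : mu.-integrable `[x, y[%classic (EFin \o cst c).
  apply: (@integrableS _ _ _ mu `[x, y]%classic) => //.
    by move=> t /=; rewrite !in_itv/= => /andP[-> /ltW].
  apply: continuous_compact_integrable; first exact: segment_compact.
  by apply: continuous_subspaceT => ?; exact: cvg_cst.
have cE (c : R) : c * (y - x) = \int[mu]_(_ in `[x, y[%classic) c.
  rewrite Rintegral_cst//= lebesgue_measure_itv/= lte_fin.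
  by case: (ltgtP x y) xy => //= -> _; rewrite subrr.
rewrite survivalB// !cE; apply/andP; split; apply: le_Rintegral => //=;
  try exact: intc; try exact: density_integrableS;
  by move=> t /=; rewrite in_itv/= => /fb /andP[].
Qed.

Lemma survival_left (lo hi x : R) : supported_on f lo hi -> x <= lo -> q x = 1.
Proof.
move=> sf xlo; rewrite /survival /Defs.cdf integral0_eq ?subr0// => t /=.
by rewrite in_itv/= => tx; rewrite sf//; left; lra.
Qed.

Lemma survival_right (lo hi x : R) : supported_on f lo hi -> hi < x -> q x = 0.
Proof.
move=> sf xhi; case: f_density => mf [f0 f1].
apply/eqP; rewrite subr_eq0 eq_sym /Defs.cdf; apply/eqP.
suff -> : (\int[mu]_(t in `]-oo, x[) (f t)%:E = \int[mu]_t (f t)%:E)%E by rewrite f1.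
rewrite integral_mkcond; apply: eq_integral => t _; rewrite patchE.
case: ifPn => // /negP; rewrite inE/= in_itv/= => /negP; rewrite -leNgt => xt.
by rewrite sf//; right; lra.
Qed.

(** On [[x, y[] the density is hazard rate times [q]: the first factor lies between [h x] and [h y],
    the second between [q y] and [q x]. Integrating the product of these bounds gives both sides. *)
Lemma MHR_survivalB (x y : R) : MHR f -> x <= y -> 0 < q y ->
  f x / q x * q y * (y - x) <= q x - q y <= f y / q y * q x * (y - x).
Proof.
move=> mhr xy qy; apply: survivalB_bounds => // t /andP[xt ty].
have qt : q y <= q t by apply: survival_nonincreasing; exact: ltW.
have qtx : q t <= q x by exact: survival_nonincreasing.
have qt0 : 0 < q t by exact: lt_le_trans qt.
have fE : f t = f t / q t * q t by rewrite divfK// gt_eqF.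
have h0 z : 0 <= f z / q z.
  by rewrite divr_ge0 ?survival_ge0//; case: f_density => _ [].
rewrite fE; apply/andP; split; apply: ler_pM; rewrite ?h0 ?survival_ge0//.
  exact: mhr.
by apply: mhr => //; exact: ltW.
Qed.

End SurvivalFunction.

(** * Revenue curves of MHR distributions *)

Section OptimalPrice.
Context (R : realType) (f : R -> R) (H p : R).
Context (f_density : is_density f) (f_supp : supported_on f 1 H) (f_mhr : MHR f).
Context (p_opt : forall x, Rev f x <= Rev f p).
Local Notation q := (survival f).
Local Notation h x := (f x / survival f x).

Lemma Rev_opt_ge1 : 1 <= Rev f p.
Proof.
apply: le_trans (p_opt 1); rewrite /Rev mul1r.
by rewrite (survival_left f_supp).
Qed.

Lemma opt_ge1 : 1 <= p.
Proof.
rewrite leNgt; apply/negP => p1; have := Rev_opt_ge1.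
rewrite /Rev (survival_left f_supp (ltW p1)); lra.
Qed.

Lemma survival_opt_gt0 : 0 < q p.
Proof.
have := Rev_opt_ge1; have := opt_ge1; rewrite /Rev.
have := survival_ge0 f_density p; rewrite le_eqVlt => /orP[/eqP <-|//].
lra.
Qed.

Lemma opt_leH : p <= H.
Proof.
rewrite leNgt; apply/negP => pH; have := survival_opt_gt0.
by rewrite (survival_right f_density f_supp)// ltxx.
Qed.

Let survival_gt0 x : x <= p -> 0 < q x.
Proof.
move=> xp; apply: lt_le_trans survival_opt_gt0 _.
exact: survival_nonincreasing.
Qed.

Let hazard_ge0 x : 0 <= h x.
Proof. by rewrite divr_ge0 ?survival_ge0//; case: f_density => _ []. Qed.

(** Were [x * h x > 1], the lower hazard bound on [q x - q p] would give [x * q x > p * q p]. *)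
Lemma hazard_before_opt (x : R) : 0 < x -> x < p -> x * h x <= 1.
Proof.
move=> x0 xp; rewrite leNgt; apply/negP => hx.
have := MHR_survivalB f_density f_mhr (ltW xp) survival_opt_gt0.
move=> /andP[+ _]; have := p_opt x; have := survival_opt_gt0; rewrite /Rev.
move: hx; set k := h x; move: (q x) (q p) => u v hx v0 uv kv.
have : x * (v + k * v * (p - x)) <= x * u by rewrite ler_pM2l//; lra.
have : 0 < (x * k - 1) * (v * (p - x)) by rewrite mulr_gt0 ?subr_gt0 ?mulr_gt0 ?subr_gt0.
lra.
Qed.

(** A discrete form of q(y) = exp(- int_0^y h) with h <= 1/y: each of ten steps of length [y / 10]
    keeps at least 9/10 of [q]. *)
Lemma survival_before_opt (y : R) : 0 < y -> y < p -> (9 / 10) ^+ 10 <= q y.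
Proof.
move=> y0 yp.
have hy : y * h y <= 1 by exact: hazard_before_opt.
have step (j : nat) : (j <= 10)%N -> (9 / 10) ^+ j <= q (j%:R * (y / 10)).
  elim: j => [_|j IH j10].
    by rewrite expr0 mul0r (survival_left f_supp).
  have jy : j.+1%:R * (y / 10) <= y.
    have : (j.+1%:R : R) <= 10 by rewrite ler_nat.
    nra.
  have jS : j.+1%:R * (y / 10) - j%:R * (y / 10) = y / 10 by rewrite -natr1; ring.
  have jj : j%:R * (y / 10) <= j.+1%:R * (y / 10) by rewrite -subr_ge0 jS; lra.
  have jp := le_lt_trans jy yp.
  have := IH (ltnW j10); move: (j%:R * _) (j.+1%:R * _) jy jS jj jp => x x' jy jS jj jp.
  have := MHR_survivalB f_density f_mhr jj (survival_gt0 (ltW jp)).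
  move=> /andP[_]; rewrite jS.
  have := f_mhr jy (survival_gt0 (ltW yp)).
  have := survival_ge0 f_density x; have := hazard_ge0 x'.
  rewrite exprS; move: (q x) (q x') (h x') (h y) hy => u v k k' hy k0 u0 kk' uv eu.
  have ky : k * y <= k' * y by rewrite ler_pM2r.
  have : 0 <= (1 - k * y) * u by apply: mulr_ge0 => //; lra.
  lra.
have := step 10%N (leqnn _).
by rewrite mulrCA divff ?mulr1// pnatr_eq0.
Qed.

(** The previous bound holds strictly below [p]. A last step of length [d] with [h p * d <= 1 / 10]
    costs one more factor 9/10, and (9/10)^11 > 31/100. *)
Lemma survival_opt_ge : 31 / 100 <= q p.
Proof.
have p1 := opt_ge1; have k0 := hazard_ge0 p.
have [d [d0 d1 dk]] : exists d, [/\ 0 < d, d <= 1 / 10 & h p * d <= 1 / 10].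
  move: (h p) k0 => k k0; exists (10 * (1 + k))^-1.
  have d0 : 0 < (10 * (1 + k))^-1 by rewrite invr_gt0; lra.
  have : (10 * (1 + k))^-1 * (10 * (1 + k)) = 1 by rewrite mulVf// gt_eqF//; lra.
  move: (_^-1) d0 => d d0 dk.
  have dk0 : 0 <= k * d by rewrite mulr_ge0// ltW.
  by split; lra.
have dp : 0 < p - d by lra.
have := survival_before_opt dp ltac:(lra).
have := MHR_survivalB f_density f_mhr (_ : p - d <= p) survival_opt_gt0.
move=> /(_ ltac:(lra)) /andP[_]; rewrite subKr.
move: dk; move: (q p) (q (p - d)) (h p) k0 (survival_ge0 f_density (p - d)).
move=> v u k k0 u0 dk uv eu.
have : 0 <= (1 / 10 - k * d) * u by rewrite mulr_ge0//; lra.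
rewrite !exprS expr0 in eu; lra.
Qed.

(** If [a * h a >= 1], the lower hazard bound on [a, b] suffices. If [a * h a < 1] and [p < a], the
    upper bound on [p, a] would make [a] earn more than [p]. *)
Lemma Rev_after_opt (a b : R) : p <= a -> a < b -> Rev f b <= Rev f a.
Proof.
move=> pa ab; have p1 := opt_ge1.
have := survival_ge0 f_density b; rewrite le_eqVlt => /orP[/eqP qb0|qb].
  by rewrite /Rev -qb0 mulr0 mulr_ge0 ?survival_ge0//; lra.
have qab := survival_nonincreasing f_density (ltW ab).
have qa : 0 < q a by exact: lt_le_trans qab.
have [ha|ha] := leP 1 (a * h a).
  have := MHR_survivalB f_density f_mhr (ltW ab) qb => /andP[+ _].
  rewrite /Rev; move: ha; set k := h a; move: (q a) (q b) qb => u v v0 ha kv.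
  have : a * (v + k * v * (b - a)) <= a * u by rewrite ler_pM2l; lra.
  have : 0 <= (a * k - 1) * (v * (b - a)).
    by rewrite mulr_ge0 ?subr_ge0// mulr_ge0// ?subr_ge0 ltW.
  lra.
move: pa; rewrite le_eqVlt => /orP[/eqP <-|pa]; first exact: p_opt.
exfalso; have := p_opt a; apply/negP; rewrite -ltNge.
have := MHR_survivalB f_density f_mhr (ltW pa) qa => /andP[_].
have := survival_opt_gt0; rewrite /Rev.
move: ha; set k := h a; move: (q p) (q a) => u v ha u0 kv.
have : a * (u - k * u * (a - p)) <= a * v by rewrite ler_pM2l; lra.
have : 0 < (1 - a * k) * (u * (a - p)) by rewrite mulr_gt0 ?subr_gt0 ?mulr_gt0 ?subr_gt0.
lra.
Qed.

(* Both chords are compared with the slope [q b * (1 - b * h b)] of [Rev] at [b]. *)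
Lemma Rev_concave_before_opt (a b : R) : 0 < a -> a < b -> b < p ->
  (Rev f p - Rev f b) * (b - a) <= (Rev f b - Rev f a) * (p - b).
Proof.
move=> a0 ab bp.
have hb := hazard_before_opt (lt_trans a0 ab) bp.
have k0 := hazard_ge0 b; have qb := survival_gt0 (ltW bp).
have := MHR_survivalB f_density f_mhr (ltW bp) survival_opt_gt0 => /andP[+ _].
have := MHR_survivalB f_density f_mhr (ltW ab) qb => /andP[_].
rewrite /Rev; move: (q a) (q b) (q p) qb (h b) hb k0 => u v w v0 k hb k0 uv vw.
have [s sE] : exists s, s = v * (1 - b * k) by eexists.
(* The hazard bounds read [w * (1 + k * (p - b)) <= v] and [u * (1 - k * (b - a)) <= v]; both
   factors are positive, and each chord bound is proved after multiplying by its factor. *)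
have kt : 0 < 1 + k * (p - b) by rewrite ltr_pwDl// mulr_ge0// subr_ge0 ltW.
have ks : 0 < 1 - k * (b - a).
  have [->|kn0] := eqVneq k 0; first by lra.
  have : 0 < k * a by rewrite mulr_gt0// lt_def kn0.
  lra.
have right : p * w - b * v <= s * (p - b).
  rewrite -(ler_pM2r kt) -subr_ge0.
  have : 0 <= p * (v - w - k * w * (p - b)) by apply: mulr_ge0; lra.
  have : 0 <= k * (p - b) ^+ 2 * (1 - b * k) * v.
    by rewrite !mulr_ge0 ?sqr_ge0//; lra.
  rewrite sE; lra.
have left : s * (b - a) <= b * v - a * u.
  rewrite -(ler_pM2r ks) -subr_ge0.
  have : 0 <= a * (k * u * (b - a) - (u - v)) by apply: mulr_ge0; lra.
  have : 0 <= k * (b - a) ^+ 2 * (1 - b * k) * v.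
    by rewrite !mulr_ge0 ?sqr_ge0//; lra.
  rewrite sE; lra.
have : (p * w - b * v) * (b - a) <= s * (p - b) * (b - a) by rewrite ler_pM2r// subr_gt0.
have : s * (b - a) * (p - b) <= (b * v - a * u) * (p - b) by rewrite ler_pM2r// subr_gt0.
lra.
Qed.

End OptimalPrice.

(** * Query trees and concentration *)

Section QueryTrees.
Context (R : realType) (q : R -> R) (q01 : forall p, 0 <= q p <= 1) (P : pred R).
Local Notation success := (prob q P).
Implicit Types (t : qtree R) (p : R) (m : nat).

Lemma prob_ge0 t : 0 <= success t.
Proof.
elim: t => [p|p k IH] /=; first exact: ler0n.
by have /andP[? ?] := q01 p; rewrite addr_ge0 ?mulr_ge0 ?subr_ge0.
Qed.

(* Multiplying the number [c] of purchases into [expR (l * c)] makes the two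
   exponential error terms factor along the independent queries. *)
Lemma prob_post_mgf p m (k : nat -> qtree R) (l A B b : R) :
  (forall c, 1 - success (k c) <= b + A * expR l ^+ c + B * expR (- l) ^+ c) ->
  1 - success (post p m k) <= b + A * (q p * expR l + (1 - q p)) ^+ m
                                + B * (q p * expR (- l) + (1 - q p)) ^+ m.
Proof.
elim: m k A B => [|m IH] k A B kP /=; first exact: kP.
have /andP[q0 q1] := q01 p.
have IHb (c0 : nat) : 1 - success (post p m (fun c => k (c0 + c)%N)) <=
    b + A * expR l ^+ c0 * (q p * expR l + (1 - q p)) ^+ m
      + B * expR (- l) ^+ c0 * (q p * expR (- l) + (1 - q p)) ^+ m.
  by apply: IH => c; rewrite -!mulrA -!exprD; exact: kP.
have q1' : 0 <= 1 - q p by rewrite subr_ge0.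
have := lerD (ler_wpM2l q0 (IHb 1)) (ler_wpM2l q1' (IHb 0)).
rewrite !exprS !expr0 !mulr1; lra.
Qed.

(** From exp(x) (1 - x) <= 1 and (1 + x + 2 x^2)(1 - x) = 1 + x^2 (1 - 2 x). *)
Lemma expR_le_quadratic (x : R) : x <= 1 / 2 -> expR x <= 1 + x + 2 * x ^+ 2.
Proof.
move=> x12; have := expR_ge1Dx (- x); have e0 := expR_gt0 x.
rewrite expRN => h; have : expR x * (1 - x) <= 1.
  by rewrite -[leRHS](mulfV (lt0r_neq0 e0)) ler_pM2l.
have : 1 <= (1 + x + 2 * x ^+ 2) * (1 - x).
  have : 0 <= x ^+ 2 * (1 - 2 * x) by rewrite mulr_ge0 ?sqr_ge0//; lra.
  lra.
move=> h1 h2; rewrite -(@ler_pM2r _ (1 - x)); lra.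
Qed.

Lemma bernoulli_mgf_le (u l : R) : 0 <= u <= 1 -> l <= 1 / 2 ->
  u * expR l + (1 - u) <= expR (u * l + 2 * l ^+ 2).
Proof.
move=> /andP[u0 u1] l12; apply: le_trans (expR_ge1Dx _).
have := ler_wpM2l u0 (expR_le_quadratic l12).
have : 0 <= (1 - u) * l ^+ 2 by rewrite mulr_ge0 ?sqr_ge0//; lra.
lra.
Qed.

(** A two-sided Chernoff bound phrased for continuations: the deviation probability is added to the
    failure probability [b] of what follows. *)
Lemma prob_post_ge p m (k : nat -> qtree R) (eta b : R) :
  0 < eta <= 1 -> 0 <= b ->
  (forall c, `|Defs.frac R c m - q p| <= eta -> 1 - b <= success (k c)) ->
  1 - (b + 2 * expR (- (m%:R * eta ^+ 2 / 8))) <= success (post p m k).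
Proof.
move=> /andP[eta0 eta1] b0 kP; have q01p := q01 p.
(* With no sample the error term is 2, so the bound is trivial. *)
have [->|m0] := posnP m.
  by rewrite mul0r mul0r oppr0 expR0 (le_trans _ (prob_ge0 _))//; lra.
have mR0 : 0 < m%:R :> R by rewrite ltr0n.
(* This tilt minimizes [2 * l ^+ 2 - l * eta], with value [- eta ^+ 2 / 8]. *)
pose l : R := eta / 4.
pose A : R := expR (- (l * (m%:R * (q p + eta)))).
pose B : R := expR (l * (m%:R * (q p - eta))).
have A0 : 0 < A by exact: expR_gt0.
have B0 : 0 < B by exact: expR_gt0.
have kAB c : 1 - success (k c) <= b + A * expR l ^+ c + B * expR (- l) ^+ c.
  have Ac0 : 0 < A * expR l ^+ c by rewrite mulr_gt0 ?exprn_gt0 ?expR_gt0.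
  have Bc0 : 0 < B * expR (- l) ^+ c by rewrite mulr_gt0 ?exprn_gt0 ?expR_gt0.
  have := prob_ge0 (k c).
  (* If the fraction is off by more than [eta], one of the two exponential terms is at least 1 and
     so covers the failure. *)
  have [/kP|] := leP `|Defs.frac R c m - q p| eta; first by lra.
  have cE : c%:R = Defs.frac R c m * m%:R by rewrite /Defs.frac divfK// gt_eqF.
  rewrite ltr_normr => /orP[cq|cq].
    suff : 1 <= A * expR l ^+ c by lra.
    rewrite -expRM_natl -expRD -[leLHS]expR0 ler_expR cE.
    have : 0 <= l * m%:R * (Defs.frac R c m - (q p + eta)).
      by rewrite !mulr_ge0 ?divr_ge0//; lra.
    lra.
  suff : 1 <= B * expR (- l) ^+ c by lra.
  rewrite -expRM_natl -expRD -[leLHS]expR0 ler_expR cE.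
  have : 0 <= l * m%:R * (q p - eta - Defs.frac R c m).
    by rewrite !mulr_ge0 ?divr_ge0//; lra.
  lra.
have := prob_post_mgf p m kAB.
suff [hA hB] : A * (q p * expR l + (1 - q p)) ^+ m <= expR (- (m%:R * eta ^+ 2 / 8)) /\
    B * (q p * expR (- l) + (1 - q p)) ^+ m <= expR (- (m%:R * eta ^+ 2 / 8)) by lra.
have mgf0 x : 0 <= q p * expR x + (1 - q p).
  by rewrite addr_ge0 ?mulr_ge0 ?expR_ge0//; lra.
split.
  apply: le_trans (_ : A * expR (q p * l + 2 * l ^+ 2) ^+ m <= _).
    by rewrite ler_pM2l// lerXn2r ?nnegrE ?expR_ge0// bernoulli_mgf_le// /l; lra.
  by rewrite -expRM_natl -expRD ler_expR /l; lra.
apply: le_trans (_ : B * expR (q p * (- l) + 2 * (- l) ^+ 2) ^+ m <= _).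
  by rewrite ler_pM2l// lerXn2r ?nnegrE ?expR_ge0// bernoulli_mgf_le// /l; lra.
by rewrite -expRM_natl -expRD ler_expR /l; lra.
Qed.

(** A union bound in continuation form: each batch of [m] queries charges [rho], with no joint
    sample space for the adaptive run. *)
Definition accurate m (eta rho : R) := forall p (k : nat -> qtree R) (b : R),
  0 <= b -> (forall c, `|Defs.frac R c m - q p| <= eta -> 1 - b <= success (k c)) ->
  1 - (b + rho) <= success (post p m k).

Lemma accurate_of_large m (eta rho x : R) : 0 < eta <= 1 -> 2 * expR (- x) <= rho ->
  8 * x <= m%:R * eta ^+ 2 -> accurate m eta rho.
Proof.
move=> eta01 xrho xm p k b b0 /(prob_post_ge eta01 b0); apply: le_trans.
rewrite lerD2l lerN2 lerD2l (le_trans _ xrho)// ler_pM2l// ler_expR; lra.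
Qed.

Definition close_estimates (eta : R) (l : seq (R * R)) := forall x, x \in l ->
  exists2 v, `|v - q x.1| <= eta & x.2 = x.1 * v.

Lemma prob_estimate_ge m (eta rho b : R) (ps : seq R) (k : seq (R * R) -> qtree R) :
  accurate m eta rho -> 0 <= rho -> 0 <= b ->
  (forall l, map fst l = ps -> close_estimates eta l -> 1 - b <= success (k l)) ->
  1 - (b + (size ps)%:R * rho) <= success (estimate m ps k).
Proof.
move=> acc rho0; elim: ps k b => [|p ps IH] k b b0 kP /=.
  by rewrite mul0r addr0; exact: kP.
rewrite -natr1 mulrDl mul1r addrA; apply: acc.
  by rewrite addr_ge0 ?mulr_ge0.
move=> c pc; apply: IH => // l lps lP; apply: kP => /=; first by rewrite lps.
move=> x; rewrite inE => /predU1P[->|/lP//].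
by exists (Defs.frac R c m).
Qed.

End QueryTrees.

(** * Selecting the best estimate and counting queries *)

Lemma best_in (R : realType) (d : R * R) (l : seq (R * R)) : best d l \in d :: l.
Proof.
elim: l d => [|x l IH] d /=; first exact: mem_head.
have := IH (if d.2 < x.2 then x else d); rewrite !inE => /orP[/eqP ->|->].
  by case: ifP; rewrite eqxx ?orbT.
by rewrite !orbT.
Qed.

Lemma best_max (R : realType) (d : R * R) (l : seq (R * R)) x :
  x \in d :: l -> x.2 <= (best d l).2.
Proof.
have best_ge (e : R * R) s : e.2 <= (best e s).2.
  elim: s e => //= y s IH e; apply: (le_trans _ (IH _)).
  by case: ifPn => // /ltW.
elim: l d => [|y l IH] d /=; first by rewrite inE => /eqP ->.
rewrite !inE => /or3P[/eqP ->|/eqP ->|xl].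
- by apply: (le_trans _ (best_ge _ _)); case: ifPn => // /ltW.
- by apply: (le_trans _ (best_ge _ _)); case: ifPn => //; rewrite -leNgt.
- by apply: IH; rewrite inE xl orbT.
Qed.

Lemma nqueries_post (R : realType) (p : R) m (k : nat -> qtree R) N :
  (forall c, nqueries (k c) <= N)%N -> (nqueries (post p m k) <= m + N)%N.
Proof.
elim: m k => [|m IH] k kN //=.
by rewrite addSn ltnS geq_max !IH.
Qed.

Lemma nqueries_estimate (R : realType) m (ps : seq R) k N :
  (forall l, nqueries (k l) <= N)%N ->
  (nqueries (estimate m ps k) <= size ps * m + N)%N.
Proof.
elim: ps k => [|p ps IH] k kN //=.
by rewrite mulSn -addnA; apply: nqueries_post => c; apply: IH.
Qed.

(** * Geometric price grids *)

Section GeometricGrid.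
Context (R : realType) (eps : R) (eps0 : 0 < eps).

(** Every set of the loop is an interval of exponents, so its state reduces to a pair [(i, n)]. *)
Definition grid (i n : nat) : seq R := [seq (1 + eps) ^+ k | k <- iota i n].

Lemma size_grid i n : size (grid i n) = n.
Proof. by rewrite size_map size_iota. Qed.

Lemma gridS i n : grid i n.+1 = (1 + eps) ^+ i :: grid i.+1 n.
Proof. by []. Qed.

Lemma last_grid (d : R) i n : last d (grid i n.+1) = (1 + eps) ^+ (i + n).
Proof. by rewrite /grid -addn1 iotaD map_cat last_cat. Qed.

Let one_lt : 1 < 1 + eps. Proof. by rewrite ltrDl. Qed.

Lemma grid_filter_le i n k : (k <= n)%N ->
  [seq p <- grid i n.+1 | (1 + eps) ^+ i <= p <= (1 + eps) ^+ (i + k)] = grid i k.+1.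
Proof.
move=> kn; rewrite /grid filter_map; congr map.
rewrite -(@filter_iota_leq n.+1 i k)//; apply: eq_in_filter => j.
by rewrite mem_iota /= !ler_eXn2l// => /andP[->].
Qed.

Lemma grid_filter_ge i n j : (j <= n)%N ->
  [seq p <- grid i n.+1 | (1 + eps) ^+ (i + j) <= p <= (1 + eps) ^+ (i + n)]
    = grid (i + j) (n - j).+1.
Proof.
move=> jn; rewrite -[n in grid i n.+1](subnKC jn) -addnS /grid iotaD map_cat filter_cat.
rewrite (_ : [seq p <- map _ (iota i j) | _] = [::]); last first.
  apply/eqP; rewrite -[_ == _]negbK -has_filter -all_predC all_map; apply/allP => k.
  rewrite mem_iota /= !ler_eXn2l// => /andP[_ kij].
  by rewrite leqNgt kij.
apply/all_filterP; rewrite all_map; apply/allP => k.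
rewrite mem_iota /= !ler_eXn2l// => /andP[-> /=]; lia.
Qed.

(** The predecessor of the first grid price above [y] is at most [y], hence the overshoot factor
    [1 + eps]. *)
Lemma head_grid_gt (d y : R) i n : (1 + eps) ^+ i <= y -> y < (1 + eps) ^+ (i + n) ->
  exists j, [/\ (0 < j)%N, (j <= n)%N,
    head d [seq p <- grid i n.+1 | y < p] = (1 + eps) ^+ (i + j),
    y < (1 + eps) ^+ (i + j) & (1 + eps) ^+ (i + j) <= (1 + eps) * y].
Proof.
elim: n i => [|n IH] i iy yn; first by have := le_lt_trans iy yn; rewrite addn0 ltxx.
have [yi|iy'] := ltP y ((1 + eps) ^+ i.+1).
  exists 1%N; rewrite addn1; split=> //; last by rewrite exprS ler_pM2l// ltr_wpDl.
  by rewrite !gridS /= ltNge iy /= yi.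
have [//||j [j0 jn hj yj jy]] := IH i.+1; first by rewrite addSnnS.
exists j.+1; rewrite -addSnnS; split=> //.
by rewrite gridS /= ltNge iy.
Qed.

Lemma bernoulli_inequality n : 1 + n%:R * eps <= (1 + eps) ^+ n.
Proof.
elim: n => [|n IH]; first by rewrite mul0r addr0 expr0.
rewrite exprS -natr1; have : (1 + eps) * (1 + n%:R * eps) <= (1 + eps) * (1 + eps) ^+ n.
  by rewrite ler_pM2l// ltr_wpDl.
have : 0 <= n%:R * eps * eps by rewrite !mulr_ge0// ltW.
lra.
Qed.

Lemma grid_bracket i n (y : R) : (1 + eps) ^+ i <= y < (1 + eps) ^+ (i + n) ->
  exists2 k, (k < n)%N & (1 + eps) ^+ (i + k) <= y < (1 + eps) ^+ (i + k).+1.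
Proof.
elim: n => [|n IH] /andP[iy yn].
  by have := le_lt_trans iy yn; rewrite addn0 ltxx.
have [yn'|ny] := ltP y ((1 + eps) ^+ (i + n)).
  by have [|k kn ky] := IH; [rewrite iy|exists k => //; lia].
by exists n; rewrite // ny -addnS.
Qed.

Lemma S1_grid (H : R) : 1 <= H ->
  exists n, [/\ S1 1 H eps = grid 0 n.+1, (1 + eps) ^+ n <= H & H < (1 + eps) ^+ n.+1].
Proof.
move=> H1; rewrite /S1 mul1r; set N := Num.truncn _.
(* By Bernoulli's inequality the finite range of exponents in [S1] already reaches beyond [H]. *)
have HN : H < (1 + eps) ^+ N.+1.
  apply: lt_le_trans (bernoulli_inequality _).
  have : H / eps < N.+1%:R by exact: truncnS_gt.
  rewrite ltr_pdivrMr//; lra.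
have [|k kN /andP[kH Hk]] := @grid_bracket 0 N.+1 H; first by rewrite expr0 H1.
exists k; split=> //.
rewrite -(@grid_filter_le 0 N k)// expr0.
rewrite (@eq_map _ _ _ (fun k => (1 + eps) ^+ k)); last by move=> j; rewrite mulr1.
rewrite /grid !filter_map; congr map; apply: eq_filter => j /=.
rewrite (exprn_ege1 _ (ltW one_lt)) /= add0n ler_eXn2l//.
apply/idP/idP => [jH|]; last by move=> jk; rewrite (le_trans _ kH)// ler_eXn2l.
by rewrite -ltnS -(ltr_eXn2l one_lt) (le_lt_trans jH).
Qed.

Lemma grid_probes i n (l r : R) : eps <= 10^-1 -> (19 <= n)%N ->
  l = (1 + eps) ^+ i -> r = (1 + eps) ^+ (i + n) ->
  exists ja jb, [/\ [/\ (0 < ja)%N, (ja < jb)%N & (jb < n)%N],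
    19 * eps * l <= r - l,
    [/\ head r [seq p <- grid i n.+1 | l + 5^-1 * (r - l) < p] = (1 + eps) ^+ (i + ja),
     l + 5^-1 * (r - l) < (1 + eps) ^+ (i + ja) &
     (1 + eps) ^+ (i + ja) <= (1 + eps) * (l + 5^-1 * (r - l))] &
    [/\ head r [seq p <- grid i n.+1 | l + 2^-1 * (r - l) < p] = (1 + eps) ^+ (i + jb),
     l + 2^-1 * (r - l) < (1 + eps) ^+ (i + jb) &
     (1 + eps) ^+ (i + jb) <= (1 + eps) * (l + 2^-1 * (r - l))]].
Proof.
move=> eps1 n19 lE rE.
have l0 : 0 < l by rewrite lE exprn_gt0// (lt_trans ltr01).
have el0 : 0 < eps * l by rewrite mulr_gt0.
(* Twenty prices make the width large against [eps * l], so that rounding the two targets up to the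
   grid keeps them apart and below [r]. *)
have Dl : 19 * eps * l <= r - l.
  have : (1 + 19 * eps) * l <= r.
    rewrite rE addnC exprD -lE ler_pM2r//; apply: le_trans (bernoulli_inequality _) _.
    by rewrite ler_eXn2l.
  by clear; lra.
have [la lb ar br] : [/\ l <= l + 5^-1 * (r - l), l <= l + 2^-1 * (r - l),
    l + 5^-1 * (r - l) < r & l + 2^-1 * (r - l) < r].
  by move: Dl el0; clear; split; lra.
have [lab brr] : (1 + eps) * (l + 5^-1 * (r - l)) < l + 2^-1 * (r - l) /\
    (1 + eps) * (l + 2^-1 * (r - l)) < r.
  have eD : eps * (r - l) <= 10^-1 * (r - l).
    by rewrite ler_wpM2r// (le_trans _ Dl)// -mulrA mulr_ge0// ltW.
  by move: Dl el0 eD; clear; split; lra.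
have [||ja [ja0 _ aE lta al]] := @head_grid_gt r (l + 5^-1 * (r - l)) i n; rewrite -?lE -?rE//.
have [||jb [jb0 _ bE ltb bl]] := @head_grid_gt r (l + 2^-1 * (r - l)) i n; rewrite -?lE -?rE//.
exists ja, jb; split=> //; split=> //.
  by rewrite -(ltn_add2l i) -(ltr_eXn2l one_lt) (le_lt_trans al)// (lt_trans lab).
by rewrite -(ltn_add2l i) -(ltr_eXn2l one_lt) -rE (le_lt_trans bl).
Qed.

End GeometricGrid.

(** * Effect of estimation errors *)

Section Accuracy.
Context (R : realType) (eps : R).

(** Since [u >= 1 / 5], an additive error [eta] is at most [5 * eta * u]. *)
Lemma estimate_relative_error (p u v eta : R) : 0 < p -> 1 / 5 <= u ->
  `|v - u| <= eta -> (1 - 5 * eta) * (p * u) <= p * v <= (1 + 5 * eta) * (p * u).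
Proof.
move=> p0 u5; rewrite ler_norml => /andP[lo hi].
have eu : 0 <= p * (eta * (5 * u - 1)) by rewrite !mulr_ge0//; lra.
have : 0 <= p * (v - (u - eta)) by rewrite mulr_ge0//; lra.
have : 0 <= p * (u + eta - v) by rewrite mulr_ge0//; lra.
lra.
Qed.

(** Here [p] is the chosen price and [p'] a near-optimal competitor. When [u] may be tiny, the error
    [p * eps / 1000] is measured against [p' * u'] through [p <= 10 * p']. Either way the extra loss
    is at most 0.06 eps. *)
Lemma rev_of_better_estimate (W p u v p' u' v' : R) : 0 < eps -> eps <= 10^-1 ->
  0 < p -> 0 < p' -> 0 <= W -> 0 <= u -> 1 / 5 <= u' ->
  `|v - u| <= eps / 1000 -> `|v' - u'| <= eps / 1000 -> p' * v' <= p * v ->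
  1 / 5 <= u \/ p <= 10 * p' ->
  (1 - 49 / 10 * eps) * W <= p' * u' -> (1 - 5 * eps) * W <= p * u.
Proof.
move=> eps0 eps1 p0 p'0 W0 u0 u'5 vu vu' p'p up Wp'.
have /andP[lo' _] := estimate_relative_error p'0 u'5 vu'.
have s0 : 0 < p' * u' by rewrite mulr_gt0//; lra.
suff h : (1 - 6 / 100 * eps) * (p' * u') <= p * u.
  have h1 : 0 <= (1 - 6 / 100 * eps) * (p' * u' - (1 - 49 / 10 * eps) * W).
    by apply: mulr_ge0; [move: eps1; clear; lra|rewrite subr_ge0].
  have h2 : 0 <= eps * W by rewrite mulr_ge0// ltW.
  have h3 : 0 <= eps * (eps * W) by rewrite !mulr_ge0// ltW.
  by move: h h1 h2 h3; clear; lra.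
have es0 : 0 <= eps * (p' * u') by rewrite mulr_ge0// ltW.
case: up => [u5|pp'].
  have /andP[_ hi] := estimate_relative_error p0 u5 vu.
  have [//|tlt] := leP ((1 - 6 / 100 * eps) * (p' * u')) (p * u).
  have h1 : eps * (p * u) <= eps * ((1 - 6 / 100 * eps) * (p' * u')).
    by rewrite ler_pM2l// ltW.
  have h2 : 0 <= eps * (eps * (p' * u')) by rewrite mulr_ge0// ltW.
  by move: lo' p'p hi es0 tlt h1 h2; clear; lra.
move: vu; rewrite ler_norml => /andP[lo hi].
have h1 : 0 <= p * (u + eps / 1000 - v).
  by apply: mulr_ge0; [exact: ltW|move: hi; clear; lra].
have h2 : 0 <= eps * (10 * p' - p) by rewrite mulr_ge0 ?subr_ge0// ltW.
have h3 : 0 <= eps * (p' * (5 * u' - 1)).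
  apply: mulr_ge0; first exact: ltW.
  by apply: mulr_ge0; [exact: ltW|move: u'5; clear; lra].
by move: h1 h2 h3 lo' p'p es0; clear; lra.
Qed.

Lemma grid_rounding_loss (W u : R) : 0 < eps -> eps <= 10^-1 -> 0 <= u ->
  W <= (1 + eps) * u -> (1 - 49 / 10 * eps) * W <= u.
Proof.
move=> eps0 eps1 u0 Wu.
have h1 : (1 - 49 / 10 * eps) * W <= (1 - 49 / 10 * eps) * ((1 + eps) * u).
  by rewrite ler_wpM2l//; move: eps1; clear; lra.
have h2 : 0 <= eps * u by rewrite mulr_ge0// ltW.
have h3 : 0 <= eps * (eps * u) by rewrite mulr_ge0// ltW.
by move: h1 h2 h3; clear; lra.
Qed.

(** The margin [eps] on each side outweighs the relative errors eps/200. *)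
Lemma comparison_sound (Ra Rb ra rb : R) : 0 < eps -> eps <= 10^-1 -> 0 <= Rb ->
  (1 - 5 * (eps / 1000)) * Ra <= ra -> rb <= (1 + 5 * (eps / 1000)) * Rb ->
  (1 + eps) * ra < (1 - eps) * rb -> Ra < Rb.
Proof.
move=> eps0 eps1 Rb0 hra hrb; rewrite !ltNge; apply: contra => RbRa.
have h1 : (1 - eps) * rb <= (1 - eps) * ((1 + 5 * (eps / 1000)) * Rb).
  by rewrite ler_wpM2l//; move: eps1; clear; lra.
have h2 : (1 + eps) * ((1 - 5 * (eps / 1000)) * Ra) <= (1 + eps) * ra.
  by rewrite ler_wpM2l//; move: eps0; clear; lra.
have h3 : 0 <= (1 + eps) * (1 - 5 * (eps / 1000)) * (Ra - Rb).
  apply: mulr_ge0; last by rewrite subr_ge0.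
  by apply: mulr_ge0; move: eps0 eps1; clear; lra.
have h4 : 0 <= eps * Rb by rewrite mulr_ge0// ltW.
by move: h1 h2 h3 h4; clear; lra.
Qed.

(* [p - b <= (1/2 + 1/19 + eps) * (r - l)] and [b - a >= (3/10 - 1/19 - eps/5) * (r - l)];
   the failed comparison bounds the chord over [a, b], and concavity transfers it to [b, p]. *)
Lemma right_probe_near_optimal (W Ra Rb ra rb a b l r p : R) :
  0 < eps -> eps <= 10^-1 -> 0 <= Rb -> Rb <= W -> 0 < l -> 19 * eps * l <= r - l ->
  a <= (1 + eps) * (l + 5^-1 * (r - l)) -> l + 2^-1 * (r - l) < b ->
  p < (1 + eps) * r -> b < p ->
  (W - Rb) * (b - a) <= (Rb - Ra) * (p - b) ->
  ra <= (1 + 5 * (eps / 1000)) * Ra -> (1 - 5 * (eps / 1000)) * Rb <= rb ->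
  (1 - eps) * rb <= (1 + eps) * ra -> (1 - 49 / 10 * eps) * W <= Rb.
Proof.
move=> eps0 eps1 Rb0 RbW l0 Dl ale bgt plt bp conc hra hrb cmp.
have D0 : 0 < r - l by apply: lt_le_trans Dl; rewrite !mulr_gt0.
(* The margins of the comparison contribute 2 eps, the two estimation errors 0.01 eps. *)
have chord : Rb - Ra <= 201 / 100 * eps * Rb.
  have h1 : (1 - eps) * ((1 - 5 * (eps / 1000)) * Rb) <= (1 - eps) * rb.
    by rewrite ler_wpM2l//; move: eps1; clear; lra.
  have h2 : (1 + eps) * ra <= (1 + eps) * ((1 + 5 * (eps / 1000)) * Ra).
    by rewrite ler_wpM2l//; move: eps0; clear; lra.
  have k0 : 0 < (1 + eps) * (1 + 5 * (eps / 1000)).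
    by apply: mulr_gt0; move: eps0; clear; lra.
  have h3 : 0 <= eps ^+ 3 * Rb by rewrite mulr_ge0// exprn_ge0// ltW.
  have h4 : 0 <= eps ^+ 2 * Rb by rewrite mulr_ge0// exprn_ge0// ltW.
  by rewrite -(ler_pM2l k0); move: h1 h2 h3 h4 cmp; clear; lra.
pose al := 1 / 2 + 1 / 19 + eps; pose be := 3 / 10 - 1 / 19 - eps / 5.
have be0 : 0 < be by rewrite /be; move: eps1; clear; lra.
have al0 : 0 < al by rewrite /al; move: eps0; clear; lra.
have pb : p - b <= al * (r - l) by rewrite /al; move: plt bgt Dl; clear; lra.
have ba : be * (r - l) <= b - a.
  have h1 : eps * (r - l) <= 10^-1 * (r - l) by rewrite ler_pM2r.
  by rewrite /be; move: h1 bgt ale Dl; clear; lra.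
have eRb : 0 <= 201 / 100 * eps * Rb.
  by apply: mulr_ge0 => //; move: eps0; clear; lra.
have main : (W - Rb) * be <= 201 / 100 * eps * Rb * al.
  rewrite -(ler_pM2r D0).
  apply: le_trans (_ : (W - Rb) * (b - a) <= _).
    by rewrite -mulrA ler_wpM2l// subr_ge0.
  apply: (le_trans conc).
  apply: le_trans (_ : 201 / 100 * eps * Rb * (p - b) <= _).
    by rewrite ler_wpM2r// subr_ge0 ltW.
  by rewrite -[leRHS]mulrA ler_wpM2l.
(* Origin of 49/10: at eps = 0 the ratio 2.01 al / be is about 4.49, and its growth with eps is
   absorbed by the factor 1 - 4.9 eps. *)
have coef : 201 / 100 * al * (1 - 49 / 10 * eps) <= 49 / 10 * be.
  have h1 : 0 <= eps * eps by rewrite mulr_ge0// ltW.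
  by rewrite /al /be; move: h1 eps0; clear; lra.
have eW : 0 <= eps * W by apply: mulr_ge0; [exact: ltW|exact: le_trans RbW].
rewrite leNgt; apply/negP => RbW'.
have h1 := ler_wpM2l eW coef.
have h2 : 0 < (be + 201 / 100 * eps * al) * ((1 - 49 / 10 * eps) * W - Rb).
  apply: mulr_gt0; last by rewrite subr_gt0.
  by rewrite addr_gt0// mulr_gt0//; move: eps0; clear; lra.
apply/negP: h2; rewrite -leNgt; move: main h1.
by move: al be {coef pb ba al0 be0}; clear => al be; lra.
Qed.

Lemma probe_widths (a b l r : R) :
  0 < eps -> eps <= 10^-1 -> 0 < l -> 19 * eps * l <= r - l ->
  l + 5^-1 * (r - l) < a -> b <= (1 + eps) * (l + 2^-1 * (r - l)) ->
  r - a <= 4 / 5 * (r - l) /\ b - l <= 4 / 5 * (r - l).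
Proof.
move=> eps0 eps1 l0 Dl la bl.
have D0 : 0 < r - l by apply: lt_le_trans Dl; rewrite !mulr_gt0.
have h : eps * (r - l) <= 10^-1 * (r - l) by rewrite ler_pM2r.
by move: h Dl la bl D0; clear; split; lra.
Qed.

(** Bounds the price ratio within the final grid, through 1.1^4 <= 3/2 and (3/2)^5 < 10. *)
Lemma one_eps_exp_le10 n : 0 < eps -> eps <= 10^-1 -> (n < 20)%N -> (1 + eps) ^+ n <= 10.
Proof.
move=> eps0 eps1 n20; apply: le_trans (_ : (1 + eps) ^+ (4 * 5) <= _).
  by rewrite ler_weXn2l//; [lra|lia].
have : (1 + eps) ^+ 4 <= 3 / 2.
  apply: le_trans (_ : (11 / 10) ^+ 4 <= _); last by rewrite !exprS expr0; lra.
  by rewrite lerXn2r ?nnegrE; lra.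
have e0 : 0 <= (1 + eps) ^+ 4 by rewrite exprn_ge0//; lra.
rewrite exprM => h4; apply: le_trans (_ : (3 / 2) ^+ 5 <= _).
  by rewrite lerXn2r ?nnegrE//; lra.
by rewrite !exprS expr0; lra.
Qed.

End Accuracy.

(** * The search loop *)

Section LoopStep.
Context (R : realType) (eps : R).
Local Notation x := (GRing.exp (1 + eps)).

Lemma loopU_small (gamma : R) M1 M2 fuel i n Scan : (n < 19)%N -> (n.+1 < fuel)%N ->
  loopU eps gamma M1 M2 fuel (grid eps i n.+1) Scan = final M2 (grid eps i n.+1) Scan.
Proof.
case: fuel => // fuel n19 _; move: (grid eps i n.+1) (size_grid eps i n.+1) => S /= ->.
by rewrite ltnS n19.
Qed.

(** One round in exponent coordinates, shared by the query count and the success bound. *)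
Lemma loopU_step (gamma : R) M1 M2 fuel i n Scan (l r : R) :
  0 < eps -> eps <= 10^-1 -> (19 <= n)%N -> l = x i -> r = x (i + n) ->
  exists ja jb a b, [/\ [/\ (0 < ja)%N, (ja < jb)%N & (jb < n)%N],
    a = x (i + ja) /\ b = x (i + jb),
    [/\ 19 * eps * l <= r - l, a <= (1 + eps) * (l + 5^-1 * (r - l))
      & l + 2^-1 * (r - l) < b],
    r - a <= 4 / 5 * (r - l) /\ b - l <= 4 / 5 * (r - l) &
    loopU eps gamma M1 M2 fuel.+1 (grid eps i n.+1) Scan =
    post b M1 (fun c =>
      if Defs.frac R c M1 < 3 / 4 * gamma
      then loopU eps gamma M1 M2 fuel (grid eps i jb.+1) Scan
      else post a M2 (fun ca => post b M2 (fun cb =>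
        if (1 + eps) * (a * Defs.frac R ca M2) < (1 - eps) * (b * Defs.frac R cb M2)
        then loopU eps gamma M1 M2 fuel (grid eps (i + ja) (n - ja).+1) (Scan ++ [:: a; b])
        else loopU eps gamma M1 M2 fuel (grid eps i jb.+1) (Scan ++ [:: a; b]))))].
Proof.
move=> eps0 eps1 n19 lE rE.
have [ja [jb [[ja0 jab jbn] Dl [aE la al] [bE lb bl]]]] := grid_probes eps0 eps1 n19 lE rE.
have l0 : 0 < l by rewrite lE exprn_gt0// (lt_trans ltr01)// ltrDl.
exists ja, jb, (x (i + ja)), (x (i + jb)); split=> //.
  exact: (probe_widths eps0 eps1 l0 Dl la bl).
have [S SE] : exists S, S = grid eps i n.+1 by exists (grid eps i n.+1).
rewrite -SE [loopU _ _ _ _ _ _ _]/= {}SE size_grid ltnNge ltnS n19 [~~ true]/=.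
rewrite last_grid (_ : head 0 (grid eps i n.+1) = x i)// -lE -rE aE bE lE rE.
rewrite (grid_filter_le eps0 i (ltnW jbn)).
by rewrite (grid_filter_ge eps0 i (ltnW (ltn_trans jab jbn))).
Qed.

Lemma iteration_budget t s : (5 * t.+1 + s + 19 = (5 * t + (s + 2) + 19).+3)%N.
Proof. lia. Qed.

(** The exponent [t] bounds the remaining rounds: a grid that is still searched has width at least
    19 eps, which rules out [t = 0], and shrinking by 4/5 lowers [t] by one. *)
Lemma width_step (i t : nat) (D : R) : 0 < eps -> 19 * eps * x i <= D ->
  D < 19 * eps * (5 / 4) ^+ t ->
  exists2 t', t = t'.+1 & forall w, w <= 4 / 5 * D -> w < 19 * eps * (5 / 4) ^+ t'.
Proof.
move=> eps0 Dl; case: t => [|t] width.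
  move: (le_lt_trans Dl width); rewrite expr0 mulr1 gtr_pMr ?mulr_gt0// ltNge.
  by rewrite exprn_ege1// lerDl ltW.
exists t => // w wD; apply: (le_lt_trans wD).
move: width; rewrite exprS mulrCA => width.
rewrite -ltr_pdivlMl; last by rewrite divr_gt0.
by rewrite invf_div.
Qed.

(* A round posts three batches and records two candidates, each of which costs one
   more batch at the end; at most 19 grid prices remain then. *)
Lemma nqueries_loopU_le (gamma : R) M1 M2 M t fuel i n Scan :
  0 < eps -> eps <= 10^-1 -> (M1 <= M)%N -> (M2 <= M)%N -> (n.+1 < fuel)%N ->
  x (i + n) - x i < 19 * eps * (5 / 4) ^+ t ->
  (nqueries (loopU eps gamma M1 M2 fuel (grid eps i n.+1) Scan)
    <= (5 * t + size Scan + 19) * M)%N.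
Proof.
move=> eps0 eps1 M1M M2M.
elim: fuel t i n Scan => // fuel IH t i n Scan nfuel width.
have [n19|n19] := ltnP n 19.
  rewrite loopU_small//; set ps := undup (Scan ++ grid eps i n.+1).
  have size_ps : (size ps <= size Scan + 19)%N.
    by rewrite (leq_trans (size_undup _))// size_cat size_grid leq_add2l.
  apply: (leq_trans (@nqueries_estimate _ _ _ _ 0 _)) => //.
  by rewrite addn0 leq_mul// (leq_trans size_ps)// leq_add2r leq_addl.
have [ja [jb [a [b [[ja0 jab jbn] [aE bE] [Dl al lb] [ra bl] ->]]]]] :=
  loopU_step gamma M1 M2 fuel Scan eps0 eps1 n19 (erefl (x i)) (erefl (x (i + n))).
have [t' -> shrink] := width_step eps0 Dl width.
have jan : (ja <= n)%N by rewrite ltnW// (ltn_trans jab).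
have sizeS' : size (Scan ++ [:: a; b]) = (size Scan + 2)%N by rewrite size_cat.
pose N := ((5 * t' + (size Scan + 2) + 19) * M)%N.
have left S' : (size S' <= size Scan + 2)%N ->
    (nqueries (loopU eps gamma M1 M2 fuel (grid eps i jb.+1) S') <= N)%N.
  move=> S'n; apply: leq_trans (IH t' _ _ _ _ _) _; first by rewrite (leq_ltn_trans jbn).
    by rewrite -bE; exact: shrink.
  by rewrite leq_mul2r leq_add2r leq_add2l S'n orbT.
apply: (@leq_trans (M1 + (M2 + (M2 + N)))); last first.
  apply: (@leq_trans (M + (M + (M + N)))); first by rewrite !leq_add.
  by rewrite /N; lia.
apply: nqueries_post => c; case: ifP => _.
  by apply: (leq_trans (left _ _)); [rewrite leq_addr|rewrite addnA leq_addl].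
apply: nqueries_post => ca; apply: nqueries_post => cb; case: ifP => _; last first.
  by apply: left; rewrite sizeS'.
apply: leq_trans (IH t' _ _ _ _ _) _.
- by rewrite ltnS in nfuel; rewrite (leq_trans _ nfuel)// ltnS ltn_subrL ja0 (leq_trans _ jan).
- by rewrite -addnA subnKC// -aE; exact: shrink.
- by rewrite sizeS'.
Qed.

End LoopStep.

(** * The loop invariant and the success probability *)

Section LoopInvariant.
Context (R : realType) (f : R -> R) (H popt eps gamma rho : R) (M1 M2 : nat).
Context (f_density : is_density f) (f_supp : supported_on f 1 H) (f_mhr : MHR f).
Context (popt_max : forall p, Rev f p <= Rev f popt).
Context (eps0 : 0 < eps) (eps1 : eps <= 10^-1).
Context (gamma_ge : 27 / 100 <= gamma) (gamma_le : gamma <= 41 / 100) (rho0 : 0 <= rho).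
Local Notation q := (survival f).
Local Notation P := (fun p => (1 - 5 * eps) * Rev f popt <= Rev f p).
Local Notation x := (GRing.exp (1 + eps)).
Context (acc1 : accurate q P M1 (1 / 1000) rho) (acc2 : accurate q P M2 (eps / 1000) rho).

Let x_gt0 k : 0 < x k. Proof. by rewrite exprn_gt0// (lt_trans ltr01)// ltrDl. Qed.
Let x_le j k : (x j <= x k) = (j <= k)%N. Proof. by rewrite ler_eXn2l// ltrDl. Qed.

(** The 0.1 eps missing from 5 eps is kept for the errors of the final selection. *)
Definition near_optimal p := (1 - 49 / 10 * eps) * Rev f popt <= Rev f p.

(* In the second alternative [p] dominates the remaining grid, which keeps the
   additive estimation errors below [p] times a constant in the final comparison. *)
Definition optimum_tracked (i n : nat) (Scan : seq R) : Prop :=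
  x i <= popt < x (i + n).+1 \/
  exists p, [/\ p \in Scan, near_optimal p & x (i + n) <= p].

(** The lower bound on [q] makes additive errors relative on recorded candidates. *)
Definition sellable (Scan : seq R) := forall p, p \in Scan -> 0 < p /\ 1 / 5 <= q p.

Lemma bracket_near_optimal k : x k <= popt < x k.+1 -> near_optimal (x k) /\ 1 / 5 <= q (x k).
Proof.
move=> /andP[kp pk].
have qk : q popt <= q (x k) by exact: survival_nonincreasing.
have q0 := survival_opt_ge f_density f_supp f_mhr popt_max.
split; last by lra.
have popt0 := lt_le_trans (x_gt0 k) kp.
apply: (grid_rounding_loss eps0 eps1).
  by rewrite mulr_ge0 ?survival_ge0// ltW.
rewrite /Rev mulrA -exprS; apply: ler_pM => //; try exact: ltW.
exact: survival_ge0.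
Qed.

Lemma Rev_ge0 p : 0 <= p -> 0 <= Rev f p.
Proof. by move=> p0; rewrite mulr_ge0 ?survival_ge0. Qed.

Lemma prob_final_ge i n Scan : (n < 19)%N -> sellable Scan -> optimum_tracked i n Scan ->
  1 - ((size Scan + 19)%:R * rho) <= prob q P (final M2 (grid eps i n.+1) Scan).
Proof.
move=> n19 Scan_ok tracked.
set ps := undup (Scan ++ grid eps i n.+1).
have grid_pos p : p \in grid eps i n.+1 -> 0 < p <= x (i + n).
  move=> /mapP[k]; rewrite mem_iota => /andP[_ kn] ->.
  by rewrite x_gt0 x_le; lia.
(* The competitor is either the grid price just below the optimum or the recorded candidate of the
   invariant. *)
have [p' [p'ps p'0 p'opt qp' p'big]] : exists p', [/\ p' \in ps, 0 < p', near_optimal p',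
    1 / 5 <= q p' & forall p, p \in grid eps i n.+1 -> p <= 10 * p'].
  case: tracked => [|[p' [p'S p'opt p'n]]].
    rewrite -addnS => /(grid_bracket eps0) [k kn kp].
    have [ko kq] := bracket_near_optimal kp.
    exists (x (i + k)); split => // [|p /grid_pos /andP[_ pn]].
      by rewrite mem_undup mem_cat orbC map_f// mem_iota leq_addr ltn_add2l.
    apply: (le_trans pn); rewrite -(subnK (kn : k <= n)%N) addnCA.
    by rewrite exprD ler_pM2r// one_eps_exp_le10// (leq_ltn_trans (leq_subr k n))// ltnW.
  have [p'0 qp'] := Scan_ok _ p'S.
  exists p'; split=> //; first by rewrite mem_undup mem_cat p'S.
  move=> p /grid_pos /andP[_ /le_trans]; apply.
  by apply: (le_trans p'n); rewrite ler_peMl ?(ltW p'0) ?ler1n.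
have size_ps : (size ps <= size Scan + 19)%N.
  by rewrite (leq_trans (size_undup _))// size_cat size_grid leq_add2l.
apply: le_trans (_ : 1 - (0 + (size ps)%:R * rho) <= _).
  by rewrite add0r lerB// ler_wpM2r// ler_nat.
rewrite /final -/ps; apply: prob_estimate_ge acc2 _ _ _ => // l lps lP /=.
(* Once all estimates are close the output is good with certainty, so the remaining failure term is
   0. *)
suff -> : P (argmax_est l) by rewrite subr0.
have l_nil : exists d s, l = d :: s.
  by case: l lps {lP} => [lps|d s _]; [rewrite -lps in p'ps|exists d, s].
have [d [s ls]] := l_nil; rewrite /argmax_est ls /=.
have best_l : best d s \in l by rewrite ls best_in.
have [v vq bv] := lP _ best_l.
have : p' \in map fst l by rewrite lps.
move=> /mapP[[p1 w] p'l p1E]; rewrite /= in p1E; rewrite -{}p1E in p'l.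
have [v' vq' /= wv'] := lP _ p'l.
have p'best : p' * v' <= (best d s).1 * v.
  by rewrite -bv -wv'; have := @best_max _ d s (p', w); rewrite -ls; exact.
have := map_f fst best_l; rewrite lps mem_undup mem_cat.
move=> bps; move: (best d s).1 bps vq p'best => p bps vq p'best.
have p0 : 0 < p.
  by case/orP: bps => [/Scan_ok []//|/grid_pos /andP[]].
apply: (rev_of_better_estimate (u' := q p') eps0 eps1 p0 p'0 _ _ _ vq vq' p'best) => //.
- by apply: le_trans (popt_max p'); rewrite mulr_ge0 ?survival_ge0// ltW.
- exact: survival_ge0.
- by case/orP: bps => [/Scan_ok []|/p'big]; [left|right].
Qed.

Lemma optimum_tracked_left i n k Scan Scan' : {subset Scan <= Scan'} -> (k <= n)%N ->
  popt <= x (i + k) -> optimum_tracked i n Scan -> optimum_tracked i k Scan'.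
Proof.
move=> sub kn pk [/andP[ip _]|[p [pS popt_p np]]]; [left|right].
  by rewrite ip (le_lt_trans pk)// ltr_eXn2l// ltrDl.
by exists p; split=> //; [exact: sub|rewrite (le_trans _ np)// x_le leq_add2l].
Qed.

Lemma optimum_tracked_right i n j Scan Scan' : {subset Scan <= Scan'} -> (j <= n)%N ->
  x (i + j) <= popt -> optimum_tracked i n Scan -> optimum_tracked (i + j) (n - j) Scan'.
Proof.
move=> sub jn jp; rewrite /optimum_tracked -addnA subnKC//.
case=> [/andP[_ pn]|[p [pS popt_p np]]]; [by left; rewrite jp|right].
by exists p; split=> //; exact: sub.
Qed.

(** The probe becomes both the witness and the new top of the grid; an older witness, if there is
    one, still dominates the smaller grid. *)
Lemma optimum_tracked_probe i n k Scan Scan' : {subset Scan <= Scan'} -> (k <= n)%N ->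
  x (i + k) \in Scan' -> (popt < x (i + n).+1 -> near_optimal (x (i + k))) ->
  optimum_tracked i n Scan -> optimum_tracked i k Scan'.
Proof.
move=> sub kn kS kopt [/andP[_ pn]|[p [pS popt_p np]]]; right.
  by exists (x (i + k)); split=> //; exact: kopt.
by exists p; split=> //; [exact: sub|rewrite (le_trans _ np)// x_le leq_add2l].
Qed.

(** If [b < popt] then [q b >= 0.31], so [v >= 0.309], above 3/4 * 41/100 = 0.3075. *)
Lemma optimum_below_unsellable (b v : R) : `|v - q b| <= 1 / 1000 ->
  v < 3 / 4 * gamma -> popt <= b.
Proof.
rewrite ler_norml => /andP[lo _] vg; rewrite leNgt; apply/negP => bp.
have := survival_nonincreasing f_density (ltW bp).
have := survival_opt_ge f_density f_supp f_mhr popt_max; have := gamma_le.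
by move=> ? ? ?; lra.
Qed.

(** The failure budget charges one [rho] per batch, with the same accounting as the query count. *)
Lemma prob_loopU_ge t fuel i n Scan :
  (n.+1 < fuel)%N -> sellable Scan -> optimum_tracked i n Scan ->
  x (i + n) - x i < 19 * eps * (5 / 4) ^+ t ->
  1 - (5 * t + size Scan + 19)%:R * rho <=
    prob q P (loopU eps gamma M1 M2 fuel (grid eps i n.+1) Scan).
Proof.
elim: fuel t i n Scan => // fuel IH t i n Scan nfuel Scan_ok tracked width.
have [n19|n19] := ltnP n 19.
  rewrite loopU_small//; apply: le_trans (prob_final_ge _ Scan_ok tracked); last by [].
  by rewrite lerB// ler_wpM2r// ler_nat -addnA leq_addl.
have [ja [jb [a [b [[ja0 jab jbn] [aE bE] [Dl al lb] [ra bl45] ->]]]]] :=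
  loopU_step gamma M1 M2 fuel Scan eps0 eps1 n19 (erefl (x i)) (erefl (x (i + n))).
have a0 : 0 < a by rewrite aE; exact: x_gt0.
have ab : a < b by rewrite aE bE ltr_eXn2l ?ltrDl// ltn_add2l.
have b0 := lt_trans a0 ab.
have [t' -> shrink] := width_step eps0 Dl width.
set S' := Scan ++ _.
have sub : {subset Scan <= S'} by move=> p pS; rewrite mem_cat pS.
have sizeS' : size S' = (size Scan + 2)%N by rewrite size_cat.
have rho_ge0 k : 0 <= k%:R * rho by rewrite mulr_ge0.
rewrite (_ : 5 * t'.+1 + size Scan + 19 = (5 * t' + size S' + 19).+3)%N; last first.
  by rewrite sizeS'; exact: iteration_budget.
set N := (5 * t' + size S' + 19)%N.
have -> : N.+3%:R * rho = N%:R * rho + rho + rho + rho by rewrite -!natr1 !mulrDl mul1r.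
apply: acc1 => [|c bc]; first by rewrite !addr_ge0.
case: ifPn => [low|]; last rewrite -leNgt => high.
  have /IH loop : (jb.+1 < fuel)%N by rewrite (leq_ltn_trans jbn).
  apply: le_trans (loop t' i Scan Scan_ok _ _).
    rewrite lerB// (le_trans _ (_ : N%:R * rho <= _))//; last by rewrite -addrA lerDl addr_ge0.
    by rewrite ler_wpM2r// ler_nat /N sizeS' leq_add2r leq_add2l leq_addr.
    apply: optimum_tracked_left tracked => //; first exact: ltnW.
    by rewrite -bE; exact: optimum_below_unsellable bc low.
  by rewrite -bE; exact: shrink.
(* Here 3/4 * 27/100 - 1/1000 = 0.2015. *)
have qb : 1 / 5 <= q b.
  by move: bc; rewrite ler_norml => /andP[_ ?]; have := gamma_ge => ?; lra.
have qa : 1 / 5 <= q a by rewrite (le_trans qb)// survival_nonincreasing// ltW.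
have S'_ok : sellable S'.
  by move=> p; rewrite mem_cat !inE => /orP[/Scan_ok//|/orP[] /eqP ->].
apply: acc2 => [|ca /(estimate_relative_error a0 qa) /andP[loa hia]].
  by rewrite addr_ge0.
apply: acc2 => [|cb /(estimate_relative_error b0 qb) /andP[lob hib]] //.
have Rb0 := Rev_ge0 (ltW b0).
case: ifPn => [cmp|]; last rewrite -leNgt => cmp.
  have RaRb := comparison_sound eps0 eps1 Rb0 loa hib cmp.
  have ap : a <= popt.
    rewrite leNgt; apply/negP => pa.
    by have := Rev_after_opt f_density f_supp f_mhr popt_max (ltW pa) ab; rewrite leNgt RaRb.
  have jan : (ja <= n)%N by rewrite ltnW// (ltn_trans jab).
  apply: (IH t') => //.
  - rewrite ltnS in nfuel; rewrite (leq_trans _ nfuel)// ltnS ltn_subrL ja0.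
    exact: leq_trans ja0 jan.
  - by apply: optimum_tracked_right tracked => //; rewrite -aE.
  - by rewrite -addnA subnKC// -aE; exact: shrink.
apply: (IH t') => //; [by rewrite (leq_ltn_trans jbn)| |by rewrite -bE; exact: shrink].
(* If the cut at [b] discards the optimum, the failed comparison and concavity make [b] itself
   near-optimal. *)
have [pb|bp] := leP popt b.
  by apply: optimum_tracked_left tracked => //; [exact: ltnW|rewrite -bE].
apply: optimum_tracked_probe tracked => //; first exact: ltnW.
  by rewrite -bE mem_cat !inE eqxx !orbT.
move=> pr; rewrite -bE; rewrite exprS in pr.
exact: (right_probe_near_optimal eps0 eps1 Rb0 (popt_max b) (x_gt0 i) Dl al lb pr bp
  (Rev_concave_before_opt f_density f_supp f_mhr popt_max a0 ab bp) hia lob cmp).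
Qed.

End LoopInvariant.

(** * Constants and budgets *)

Section Constants.
Context (R : realType).
Implicit Types x H eps delta C : R.

Lemma expR1_bounds : 244 / 100 <= expR (1 : R) <= 36 / 10.
Proof.
have E : expR (1 : R) = expR (1 / 4) ^+ 4 by rewrite -expRM_natl; congr expR; lra.
have lo := expR_ge1Dx (1 / 4 : R).
have hi : expR (1 / 4 : R) <= 11 / 8.
  have := @expR_le_quadratic R (1 / 4) ltac:(lra); lra.
rewrite E; apply/andP; split.
  apply: le_trans (_ : (5 / 4) ^+ 4 <= _); first by rewrite !exprS expr0; lra.
  by rewrite lerXn2r ?nnegrE ?expR_ge0//; lra.
apply: le_trans (_ : (11 / 8) ^+ 4 <= _); last by rewrite !exprS expr0; lra.
by rewrite lerXn2r ?nnegrE ?expR_ge0//; lra.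
Qed.

Lemma expRN1_bounds : 27 / 100 <= expR (- 1 : R) <= 41 / 100.
Proof.
rewrite expRN; have /andP[lo hi] := expR1_bounds; have e0 := expR_gt0 (1 : R).
by rewrite -(ler_pM2r e0) -[_^-1 <= _](ler_pM2r e0) mulVf ?gt_eqF//; apply/andP; split; lra.
Qed.

Lemma ceil_nat_bounds x : 0 <= x -> x <= `|Num.ceil x|%N%:R <= x + 1.
Proof.
move=> x0; have c0 : 0 <= Num.ceil x by rewrite ceil_ge0 (lt_le_trans _ x0)// ltrN10.
rewrite natr_absz ger0_norm// ceil_ge /=.
by have /andP[+ _] := ceil_itv x; rewrite intrB ltrBlDr => /ltW.
Qed.

(** Since exp(-1/5) >= 4/5, five rounds of shrinking gain at least a factor e. *)
Lemma exp_le_geometric x (t : nat) : 5 * x <= t%:R -> expR x <= (5 / 4) ^+ t.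
Proof.
move=> xt; have h : expR (1 / 5 : R) <= 5 / 4.
  have := expR_ge1Dx (- (1 / 5) : R); have e0 := expR_gt0 (1 / 5 : R).
  rewrite expRN -(ler_pM2r e0) mulVf ?gt_eqF//; lra.
apply: le_trans (_ : expR (1 / 5) ^+ t <= _).
  by rewrite -expRM_natl ler_expR; lra.
by rewrite lerXn2r ?nnegrE ?expR_ge0//; lra.
Qed.

Lemma ln_inv_ge1 eps : 0 < eps -> eps <= 10^-1 -> 1 <= ln (eps^-1).
Proof.
move=> eps0 eps1; have /andP[_ hi] := expR1_bounds.
rewrite -ler_expR lnK ?posrE ?invr_gt0// (le_trans hi)//.
apply: le_trans (_ : 10 <= _); first by lra.
by rewrite -[leLHS]invrK lef_pV2 ?posrE// invr_gt0.
Qed.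

Lemma ln_ratio H eps : 0 < H -> 0 < eps -> ln (H / eps) = ln H + ln (eps^-1).
Proof. by move=> H0 eps0; rewrite lnM ?posrE ?invr_gt0. Qed.

Lemma Rtilde_bounds H eps : 1 <= H -> 0 < eps -> eps <= 10^-1 ->
  [/\ 66 <= Rtilde 1 H eps, 2 * ln (H / eps) <= Rtilde 1 H eps,
      Rtilde 1 H eps <= 66 * ln (H / eps) ^+ 2 & 1 <= ln (H / eps)].
Proof.
move=> H1 eps0 eps1; have H0 := lt_le_trans ltr01 H1.
rewrite /Rtilde divr1 ln_ratio//.
have := ln_inv_ge1 eps0 eps1; have := ln_ge0 H1.
move: (ln H) (ln (eps^-1)) => a e a0 e1 {H1 H0 eps0 eps1}.
have ae : 0 <= a * (e - 1) by rewrite mulr_ge0// subr_ge0.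
have ee : 0 <= e * (e - 1) by rewrite mulr_ge0 ?subr_ge0// (le_trans ler01).
have aa : 0 <= (a - 1) ^+ 2 by exact: sqr_ge0.
have a2 : 0 <= a ^+ 2 by exact: sqr_ge0.
split; lra.
Qed.

(** The value 16 L makes each batch fail with probability at most 2 exp(-2 L). As e >= 2,
    [C >= 10 ^+ 7] yields 20 L; the upper bounds use e <= 4 and one unit for the ceiling. *)
Lemma samples_bounds H eps delta C (L : R) :
  0 < eps -> eps <= 10^-1 -> 10 ^+ 7 <= C -> 0 <= L ->
  L = ln (Rtilde 1 H eps / delta) ->
  [/\ 16 * L <= (m1 1 H delta eps (expR (- 1)) C)%:R * (1 / 1000) ^+ 2,
      16 * L <= (m2 1 H delta eps (expR (- 1)) C)%:R * (eps / 1000) ^+ 2,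
      (m1 1 H delta eps (expR (- 1)) C)%:R <= 4 * C * L / eps ^+ 2 + 1 &
      (m2 1 H delta eps (expR (- 1)) C)%:R <= 4 * C * L / eps ^+ 2 + 1].
Proof.
move=> eps0 eps1 C7 L0 LE; rewrite /m1 /m2 -LE expRN invrK.
have /andP[e2 e4] := expR1_bounds.
have e20 : 0 < eps ^+ 2 by rewrite exprn_gt0.
have C0 : 0 < C by apply: lt_le_trans C7; rewrite exprn_gt0.
have CL0 : 0 <= C * L by rewrite mulr_ge0// ltW.
have y0 : 0 <= C * L * expR 1 by rewrite mulr_ge0// expR_ge0.
have lo : 10 ^+ 7 * 2 * L <= C * L * expR 1.
  have h1 : 10 ^+ 7 * L <= C * L by rewrite ler_wpM2r.
  have h2 : C * L * 2 <= C * L * expR 1 by rewrite ler_wpM2l//; lra.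
  by move: h1 h2; clear; lra.
have hi : C * L * expR 1 <= 4 * C * L.
  have h2 : C * L * expR 1 <= C * L * 4 by rewrite ler_wpM2l//; lra.
  by move: h2; clear; lra.
move: (C * L * expR 1) y0 lo hi => y y0 lo hi.
have ye0 : 0 <= y / eps ^+ 2 by rewrite divr_ge0// ltW.
have /andP[l1 u1] := ceil_nat_bounds y0; have /andP[l2 u2] := ceil_nat_bounds ye0.
have inv1 : 1 <= (eps ^+ 2)^-1.
  by rewrite invf_ge1// exprn_ile1 ?ltW// (le_lt_trans eps1)// invf_lt1// ltr1n.
split.
- move: l1 lo L0; move: (`|_|%N%:R) => M; clear; rewrite !exprS !expr0; lra.
- move: l2; move: (`|_|%N%:R) => M; rewrite ler_pdivrMr// => l2.
  rewrite exprMn mulrA; move: (M * _) l2 lo L0 => w; clear; rewrite !exprS !expr0; lra.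
- apply: (le_trans u1); rewrite lerD2r (le_trans hi)// ler_peMr//.
  by rewrite (le_trans y0).
- by apply: (le_trans u2); rewrite lerD2r ler_pM2r ?invr_gt0.
Qed.

End Constants.

Lemma iteration_bound (R : realType) (H eps : R) (n t : nat) :
  1 <= H -> 0 < eps -> (1 + eps) ^+ n <= H -> 5 * ln (H / eps) <= t%:R ->
  (1 + eps) ^+ (0 + n) - (1 + eps) ^+ 0 < 19 * eps * (5 / 4) ^+ t.
Proof.
move=> H1 eps0 nH /exp_le_geometric; have H0 := lt_le_trans ltr01 H1.
rewrite lnK ?posrE ?divr_gt0// ler_pdivrMr// add0n expr0 => ht.
move: (_ ^+ n) (_ ^+ t) nH ht => u v uH ht.
by move: uH ht H1; clear; lra.
Qed.

(** Each of the 5t + 19 batches fails with probability at most 2 (delta / Rt)^2, and 2 (5t + 19) <=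
    98 X <= 66 * 2 X <= Rt^2; finally delta^2 <= delta. *)
Lemma failure_budget (R : realType) (X Rt delta : R) (t : nat) :
  1 <= X -> 66 <= Rt -> 2 * X <= Rt -> 0 < delta -> delta <= 1 -> t%:R <= 5 * X + 1 ->
  (5 * t + 0 + 19)%:R * (2 * expR (- (2 * ln (Rt / delta)))) <= delta.
Proof.
move=> X1 Rt66 RtX d0 d1 tX; have Rt0 : 0 < Rt by lra.
have -> : expR (- (2 * ln (Rt / delta))) = (delta / Rt) ^+ 2.
  by rewrite expRN expRM_natl lnK ?posrE ?divr_gt0// -exprVn invf_div.
rewrite addn0 natrD natrM expr_div_n !mulrA ler_pdivrMr ?exprn_gt0//.
have h1 : (5 * t%:R + 19) * 2 <= 98 * X by lra.
have h2 : 98 * X <= Rt ^+ 2.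
  have := ler_pM (ler0n R 66) (_ : 0 <= 2 * X) Rt66 RtX.
  by rewrite expr2 => /(_ ltac:(lra)); lra.
rewrite [leRHS]mulrC ler_pM2r//.
apply: le_trans (le_trans h1 h2); rewrite ler_piMr//.
Qed.

(** The fourth power leaves room for the crude bounds [ln Rt <= Rt <= 66 * X ^+ 2] and
    [X <= X ^+ 2]. The constants are 49 = 25 + 5 + 19 and 264 = 4 * 66. *)
Lemma query_budget (R : realType) (eps X Rt delta C : R) (t M : nat) :
  0 < eps -> eps <= 10^-1 -> 0 <= C -> 1 <= X -> 66 <= Rt -> Rt <= 66 * X ^+ 2 ->
  0 < delta -> delta <= 1 -> t%:R <= 5 * X + 1 ->
  M%:R <= 4 * C * ln (Rt / delta) / eps ^+ 2 + 1 ->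
  ((5 * t + 0 + 19) * M)%:R <=
    49 * (264 * C + 1) * eps ^- 2 * X ^+ 4 * (1 + ln (delta^-1)).
Proof.
move=> eps0 eps1 C0 X1 Rt66 RtX d0 d1 tX MC.
have Rt0 : 0 < Rt by lra.
have Dl0 : 0 <= ln (delta^-1) by rewrite ln_ge0// invf_ge1.
rewrite lnM ?posrE ?invr_gt0// in MC.
have lnRt := le_trans (ltW (ln_sublinear Rt0)) RtX.
have X2 : 1 <= X ^+ 2 by rewrite exprn_ege1.
have XY : X <= X ^+ 2 by rewrite expr2 ler_peMr// (le_trans ler01).
have e1 : 1 <= eps ^- 2.
  by rewrite invf_ge1 ?exprn_gt0// exprn_ile1 ?ltW// (le_lt_trans eps1)// invf_lt1// ltr1n.
move: (ln Rt) (ln delta^-1) (X ^+ 2) (X ^+ 4) (exprM X 2 2) XY lnRt X2 Dl0 MC.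
move=> a d Y Y2 Y2E XY aY Y1 d0' MC.
move: (eps ^- 2) e1 MC => e e1 MC.
have Yd : a + d <= 66 * (Y * (1 + d)).
  have h : 0 <= (Y - 1) * d by rewrite mulr_ge0// subr_ge0.
  have h' : 0 <= Y * d by rewrite mulr_ge0// (le_trans ler01).
  by move: h h' aY d0'; clear; lra.
have Yd1 : 1 <= Y * (1 + d) by rewrite mulr_ege1// lerDl.
have M1 : M%:R <= e * ((264 * C + 1) * (Y * (1 + d))).
  apply: (le_trans MC).
  have h1 : 4 * C * (a + d) * e <= 4 * C * (66 * (Y * (1 + d))) * e.
    by rewrite ler_wpM2r ?(le_trans ler01)// ler_wpM2l// mulr_ge0.
  have h2 : 1 <= e * (Y * (1 + d)) by rewrite mulr_ege1.
  by move: h1 h2; clear; lra.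
have T1 : (5 * t + 0 + 19)%:R <= 49 * Y.
  by rewrite addn0 natrD natrM; move: XY tX Y1; clear; lra.
rewrite natrM; apply: le_trans (ler_pM _ _ T1 M1) _ => //.
by rewrite Y2E expr2; lra.
Qed.

Lemma scaled_accuracy (R : realType) (e : R) : 0 < e -> e <= 1 -> 0 < e / 1000 <= 1.
Proof. by move=> e0 e1; apply/andP; split; lra. Qed.

(** The factor [1 + ln (delta^-1)] replaces ln(1/delta), which vanishes at delta = 1. *)
Theorem theorem4p2 :
  exists C0 : nat, forall (R : realType) (C : R), C0%:R <= C ->
  exists K : R, forall (H eps delta : R) (f : R -> R),
    1 <= H -> 0 < eps -> eps <= 10^-1 -> 0 < delta -> delta <= 1 ->
    is_density f -> supported_on f 1 H -> MHR f ->
    (forall popt : R, (forall p : R, Rev f p <= Rev f popt) ->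
       1 - delta <=
       prob (survival f) (fun p => (1 - 5 * eps) * Rev f popt <= Rev f p)
            (algU 1 H delta eps (expR (-1)) C))
    /\
    (nqueries (algU 1 H delta eps (expR (-1)) C))%:R
      <= K * eps ^-2 * ln (H / eps) ^+ 4 * (1 + ln (delta^-1)).
Proof.
exists (10 ^ 7)%N => R C; rewrite natrX => C7.
exists (49 * (264 * C + 1)) => H eps delta f H1 eps0 eps1 d0 d1 f_density f_supp f_mhr.
have [Rt66 RtX RtX2 X1] := Rtilde_bounds H1 eps0 eps1.
have Rt0 : 0 < Rtilde 1 H eps by apply: lt_le_trans Rt66.
set X := ln (H / eps) in RtX RtX2 X1 *.
have [n [S1E nH Hn]] := S1_grid eps0 H1.
have X5 : 0 <= 5 * X by rewrite mulr_ge0// (le_trans ler01).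
have /andP[tX Xt] := ceil_nat_bounds X5.
set t := `|_|%N in tX Xt.
have width := iteration_bound H1 eps0 nH tX.
have C0 : 0 <= C by apply: le_trans C7; rewrite exprn_ge0.
pose L := ln (Rtilde 1 H eps / delta).
have L0 : 0 <= L.
  by rewrite ln_ge0// ler_pdivlMr// mul1r (le_trans d1)// (le_trans _ Rt66)// ler1n.
have [M1lo M2lo M1hi M2hi] := samples_bounds eps0 eps1 C7 L0 (erefl L).
rewrite /algU S1E size_grid; split=> [popt popt_max|].
  have q01 p : 0 <= survival f p <= 1 by rewrite survival_ge0// survival_le1.
  (* The invariant starts in its bracketing alternative: the optimum is at most [H], which lies
     below the first power left out of the grid. *)
  have start : 1 <= popt < (1 + eps) ^+ n.+1.
    rewrite (opt_ge1 f_supp popt_max) (le_lt_trans _ Hn)//.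
    exact: opt_leH f_density f_supp popt_max.
  have eta1 := scaled_accuracy (@ltr01 R) (lexx 1).
  have eta2 : 0 < eps / 1000 <= 1.
    by rewrite scaled_accuracy// (le_trans eps1)// invf_le1// ler1n.
  have /andP[g1 g2] := expRN1_bounds R.
  have rho0 : 0 <= 2 * expR (- (2 * L)) by rewrite mulr_ge0// expR_ge0.
  apply: le_trans (prob_loopU_ge f_density f_supp f_mhr popt_max eps0 eps1 g1 g2 rho0
    _ _ _ _ _ width).
  - by rewrite lerD2l lerN2; exact: failure_budget Xt.
  - apply: (accurate_of_large q01 eta1 (lexx _)).
    by rewrite mulrA -natrM.
  - apply: (accurate_of_large q01 eta2 (lexx _)).
    by rewrite mulrA -natrM.
  - by [].
  - by [].
  - by left; rewrite expr0 add0n.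
move: (m1 _ _ _ _ _ _) (m2 _ _ _ _ _ _) M1hi M2hi {M1lo M2lo} => M1 M2 M1hi M2hi.
have Mhi : (maxn M1 M2)%:R <= 4 * C * L / eps ^+ 2 + 1 by case: leqP.
apply: le_trans (query_budget eps0 eps1 C0 X1 Rt66 RtX2 d0 d1 Xt Mhi).
by rewrite ler_nat nqueries_loopU_le ?leq_maxl ?leq_maxr.
Qed.
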